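(* Let $\lambda$ and $\mu$ be partitions with $\mu\subset\lambda$ and $\ell(\lambda)\le n$. For any sequences $\mathbf x=(x_0,x_1,\dots)$ and $\mathbf y=(y_0,y_1,\dots)$ of variables, \[ S^n_{\lambda/\mu}(|\mathbf x|+\mathbf y)=\sum_{\mu\subset\nu\subset\lambda}L^n_{\lambda/\nu}(\mathbf x)\,S^n_{\nu/\mu}(\mathbf y), \] where the sum is over partitions $\nu$ with $\mu\subset\nu\subset\lambda$, $|\mathbf x|=x_0+x_1+\cdots$, and $|\mathbf x|+\mathbf y=(|\mathbf x|+y_0,|\mathbf x|+y_1,\dots)$.
   Context: $\mathbb N=\{0,1,2,\dots\}$. A partition $\lambda$ is identified with its Young diagram $\{(i,j):1\le i\le \ell(\lambda),\,1\le j\le\lambda_i\}$, where $\ell(\lambda)$ is the number of (positive) parts; $\mu\subset\lambda$ means containment of diagrams and $\lambda/\mu$ is the set difference. The content of a cell is $c(i,j)=j-i$. A tableau of shape $\lambda/\mu$ is a map $T:\lambda/\mu\to\mathbb N$, and $\mathbf x^T=\prod_{(i,j)\in\lambda/\mu}x_{T(i,j)}$. $\mathrm{LHT}_n(\lambda/\mu)$ is the set of $n$-lecture hall tableaux: tableaux $L$ of shape $\lambda/\mu$ such that \[ \frac{L(i,j)}{n+c(i,j)}\ge\frac{L(i,j+1)}{n+c(i,j+1)},\qquad \frac{L(i,j)}{n+c(i,j)}>\frac{L(i+1,j)}{n+c(i+1,j)} \] whenever the cells involved lie in $\lambda/\mu$. For such $L$, $\lfloor L\rfloor$ is the tableau with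 $(i,j)$-entry $\lfloor L(i,j)/(n-i+j)\rfloor$. $\mathrm{SSCT}_n(\lambda/\mu)$ is the set of semistandard $n$-content tableaux: tableaux $S$ of shape $\lambda/\mu$ with entries weakly decreasing along rows, strictly decreasing down columns, and $0\le S(i,j)<n-i+j$ for every $(i,j)\in\lambda/\mu$. Generating functions (formal power series): \[ L^n_{\lambda/\mu}(\mathbf x)=\sum_{T\in\mathrm{LHT}_n(\lambda/\mu)}\mathbf x^{\lfloor T\rfloor},\qquad S^n_{\lambda/\mu}(\mathbf x)=\sum_{T\in\mathrm{SSCT}_n(\lambda/\mu)}\mathbf x^{T}. \] $S^n_{\lambda/\mu}(|\mathbf x|+\mathbf y)$ is the (finite) sum $S^n_{\lambda/\mu}$ with its $k$-th variable replaced by $|\mathbf x|+y_k$, $k\ge0$. *)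

(* Defs.v *)
From HB Require Import structures.
From mathcomp Require Import all_boot all_order all_algebra finmap multiset.
From mathcomp Require Import boolp classical_sets functions cardinality fsbigop.

Set Implicit Arguments.
Unset Strict Implicit.
Unset Printing Implicit Defensive.

Import Order.TTheory GRing.Theory Num.Theory.

Local Open Scope classical_set_scope.
Local Open Scope fset_scope.
Local Open Scope mset_scope.
Local Open Scope ring_scope.

(** A monomial in the variables [V] is the finite multiset of its variables, so
    that [`+`] is the product of monomials.  A series is the function giving the
    coefficient of each monomial. *)

Definition fps (R : comNzRingType) (V : choiceType) : Type := {mset V} -> R.

HB.instance Definition _ (R : comNzRingType) (V : choiceType) :=
  Choice.copy (fps R V) ({mset V} -> R).
HB.instance Definition _ (R : comNzRingType) (V : choiceType) :=
  GRing.Zmodule.copy (fps R V) ({mset V} -> R).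

Section FpsRing.
Variables (R : comNzRingType) (V : choiceType).
Implicit Types (m a b c : {mset V}) (f g h : fps R V).

(* Coefficients of a Cauchy product: the index set is finite ([fps_mul_index_finite]). *)
Definition fps_mul f g : fps R V := fun m =>
  \sum_(p \in [set p : {mset V} * {mset V} | p.1 `+` p.2 = m]) (f p.1 * g p.2).

Definition fps_one : fps R V := fun m => (m == mset0)%:R.

Definition fpsX (v : V) : fps R V := fun m => (m == [mset v])%:R.

Lemma msub_finite m : finite_set [set a | a `<=` m].
Proof.
pose k := (\max_(v : finsupp m) m (val v)).+1.
pose D := {ffun finsupp m -> 'I_k}.
pose G (F : D) : {mset V} := [fsfun v : finsupp m => (F v : nat)].
apply: (@sub_finite_set _ _ (G @` setT)); last exact/finite_image/finite_finset.
move=> a /= /msubsetP am.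
have lt_ak (v : finsupp m) : (a (val v) < k)%N.
  by rewrite ltnS (leq_trans (am _)) // (leq_bigmax v).
exists [ffun v => Ordinal (lt_ak v)] => //.
apply/msetP => v; rewrite /G fsfun_ffun.
case: insubP => [u _ <-|]; first by rewrite /= ffunE.
rewrite mem_finsupp negbK => /eqP m0.
by move: (am v); rewrite m0 leqn0 => /eqP ->.
Qed.

Lemma fps_mul_index_finite m :
  finite_set [set p : {mset V} * {mset V} | p.1 `+` p.2 = m].
Proof.
apply: sub_finite_set (finite_setX (msub_finite m) (msub_finite m)).
move=> [a b] /= <-; split; apply/msubsetP => v; rewrite /= msetE2.
- exact: leq_addr.
- exact: leq_addl.
Qed.

Let D m : {fset {mset V}} := fset_set [set a | a `<=` m].

Let inD m a : (a \in D m) = (a `<=` m).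
Proof.
rewrite in_fset_set; last exact: msub_finite.
by apply/idP/idP; rewrite inE.
Qed.

Let inDl m a b : a `+` b `<=` m -> a \in D m.
Proof.
move=> /msubsetP abm; rewrite inD; apply/msubsetP => v.
by apply: leq_trans (abm v); rewrite msetE2 leq_addr.
Qed.

Let inDr m a b : a `+` b `<=` m -> b \in D m.
Proof. by rewrite msetDC; apply: inDl. Qed.

Lemma fps_mul_bound m f g a : a `<=` m ->
  fps_mul f g a =
  \sum_(b <- D m) \sum_(c <- D m) (b `+` c == a)%:R * (f b * g c).
Proof.
move=> am.
pose F (p : {mset V} * {mset V}) := (p.1 `+` p.2 == a)%:R * (f p.1 * g p.2).
transitivity (\sum_(p <- [seq (b, c) | b <- D m, c <- D m]) F p); last first.
  by rewrite big_allpairs_dep.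
rewrite /fps_mul (eq_fsbigr F); last first.
  by move=> p; rewrite inE /F /= => ->; rewrite eqxx mul1r.
apply: fsbig_fwiden => [p /= pa||p /= [_ /eqP/negPf pa]]; last by rewrite /F pa mul0r.
- case: p pa => b c /= pa; apply: allpairs_f.
  + by apply: (@inDl _ _ c); rewrite pa.
  + by apply: (@inDr _ b); rewrite pa.
- by apply: allpairs_uniq; rewrite ?fset_uniq // => -[? ?] [? ?].
Qed.

Lemma fps_mulC : commutative fps_mul.
Proof.
move=> f g; apply/funext => m; rewrite !(fps_mul_bound _ _ (msubset_refl m)).
rewrite exchange_big; apply: eq_bigr => b _; apply: eq_bigr => c _.
by rewrite msetDC [f _ * _]mulrC.
Qed.

Lemma fps_mulA : associative fps_mul.
Proof.
suff triple f g h m : fps_mul (fps_mul f g) h m =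
    \sum_(a <- D m) \sum_(b <- D m) \sum_(c <- D m)
      (a `+` b `+` c == m)%:R * (f a * g b * h c).
  move=> f g h; apply/funext => m; rewrite fps_mulC !triple.
  under eq_bigr => b _ do rewrite exchange_big.
  rewrite exchange_big; apply: eq_bigr => a _.
  apply: eq_bigr => b _; apply: eq_bigr => c _.
  by rewrite [_ `+` a]msetDC msetDA [g b * _ * _]mulrC !mulrA.
rewrite (fps_mul_bound _ _ (msubset_refl m)).
transitivity (\sum_(e <- D m) \sum_(c <- D m) \sum_(a <- D m) \sum_(b <- D m)
    (e `+` c == m)%:R * ((a `+` b == e)%:R * (f a * g b) * h c)).
  apply: eq_big_seq => e; rewrite inD => em; apply: eq_bigr => c _.
  rewrite (fps_mul_bound _ _ em) mulr_suml mulr_sumr; apply: eq_bigr => a _.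
  by rewrite mulr_suml mulr_sumr.
under eq_bigr => e _ do rewrite exchange_big.
rewrite exchange_big; apply: eq_bigr => a _ /=.
under eq_bigr => e _ do rewrite exchange_big.
rewrite exchange_big; apply: eq_bigr => b _ /=.
rewrite exchange_big; apply: eq_bigr => c _ /=.
have [abcm|abcm] := eqVneq (a `+` b `+` c) m; last first.
  rewrite mul0r big1_seq // => e _.
  have [<-|] := eqVneq (a `+` b) e; last by rewrite !mul0r mulr0.
  by rewrite (negPf abcm) mul0r.
have abD : a `+` b \in D m by apply: (@inDl _ _ c); rewrite abcm msubset_refl.
rewrite (bigD1_seq (a `+` b)) ?fset_uniq //= big1_seq ?addr0.
  by rewrite abcm !eqxx !mul1r.
by move=> e /andP[/negPf]; rewrite eq_sym => -> _; rewrite !mul0r mulr0.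
Qed.

Lemma fps_mul1 : left_id fps_one fps_mul.
Proof.
move=> f; apply/funext => m; rewrite (fps_mul_bound _ _ (msubset_refl m)).
have m0 : mset0 \in D m by rewrite inD msub0set.
have mm : m \in D m by rewrite inD msubset_refl.
rewrite (bigD1_seq mset0) ?fset_uniq //= [X in _ + X]big1_seq ?addr0; last first.
  move=> b /andP[/negPf b0 _]; rewrite big1 // => c _.
  by rewrite /fps_one b0 mul0r mulr0.
rewrite (bigD1_seq m) ?fset_uniq //= big1_seq ?addr0.
  by rewrite mset0D /fps_one !eqxx !mul1r.
by move=> c /andP[/negPf cm _]; rewrite mset0D cm mul0r.
Qed.

Lemma fps_mulDl : left_distributive fps_mul +%R.
Proof.
move=> f g h; apply/funext => m.
transitivity (fps_mul f h m + fps_mul g h m); last by [].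
rewrite !(fps_mul_bound _ _ (msubset_refl m)) -big_split /=.
apply: eq_bigr => b _; rewrite -big_split /=; apply: eq_bigr => c _.
by rewrite -mulrDr -mulrDl.
Qed.

Lemma fps_one_neq0 : fps_one != 0.
Proof.
apply/eqP => /(congr1 (fun f : fps R V => f mset0)) /eqP.
by rewrite /fps_one eqxx oner_eq0.
Qed.

HB.instance Definition _ := GRing.Zmodule_isComNzRing.Build (fps R V)
  fps_mulA fps_mulC fps_mul1 fps_mulDl fps_one_neq0.

(* Formal sum of a possibly infinite family of series, taken coefficientwise.
   It is meaningful when the family is summable: [\sum_(i \in A)] is [0] on an
   infinite support. *)
Definition fps_summable (I : choiceType) (A : set I) (F : I -> fps R V) :=
  forall m, finite_set [set i | A i /\ F i m <> 0].

Definition fps_sum (I : choiceType) (A : set I) (F : I -> fps R V) : fps R V :=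
  fun m => \sum_(i \in A) F i m.

End FpsRing.

Record intpart := IntPart {
  parts :> seq nat;
  _ : sorted geq parts && (0%N \notin parts) }.

HB.instance Definition _ := [isSub for parts].
HB.instance Definition _ := [Choice of intpart by <:].

(* A cell is a pair (row, column), both numbered from 1. *)
Definition diagram (la : intpart) : {fset nat * nat} :=
  [fset c in [seq (i, j) | i <- iota 1 (size la),
                           j <- iota 1 (nth 0%N la i.-1)]].

Lemma in_diagram (la : intpart) i j : ((i, j) \in diagram la) =
  (0 < i <= size la)%N && (0 < j <= nth 0%N la i.-1)%N.
Proof.
rewrite inE /=; apply/allpairsPdep/andP => [[a [b [+ + [-> ->]]]]|[hi hj]].
  by rewrite !mem_iota !add1n !ltnS.
by exists i, j; rewrite !mem_iota !add1n !ltnS.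
Qed.

Lemma diagram_inj : injective diagram.
Proof.
have ltn_inj a b : (forall i, (i < a)%N = (i < b)%N) -> a = b.
  by move=> eq_ab; apply/eqP; rewrite eqn_leq [(a <= b)%N]leqNgt [(b <= a)%N]leqNgt eq_ab ltnn -eq_ab ltnn.
have nth_gt0 (la : intpart) i : (i < size la)%N -> (0 < nth 0%N la i)%N.
  case: la => s /= /andP[_ s0] si; rewrite lt0n; apply: contra s0 => /eqP <-.
  exact: mem_nth.
move=> la mu eq_d.
have eq_cell i j : (0 < i <= size la)%N && (0 < j <= nth 0%N la i.-1)%N =
    (0 < i <= size mu)%N && (0 < j <= nth 0%N mu i.-1)%N.
  by rewrite -!in_diagram eq_d.
have eq_size : size la = size mu.
  apply: ltn_inj => i; have := eq_cell i.+1 1%N.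
  rewrite /=.
  case: (ltnP i (size la)) => [/nth_gt0 ->|_] /=.
    by move/esym/andP => [-> _].
  by case: (ltnP i (size mu)) => [/nth_gt0 ->|].
apply: val_inj; apply: (@eq_from_nth _ 0%N) => // i ila.
apply: ltn_inj => j; have := eq_cell i.+1 j.+1.
by rewrite -eq_size /= ila.
Qed.

Definition part_sub (mu la : intpart) : bool := (diagram mu `<=` diagram la)%fset.

Lemma part_interval_finite (mu la : intpart) :
  finite_set [set nu : intpart | part_sub mu nu /\ part_sub nu la].
Proof.
apply: (@sub_finite_set _ _ [set nu | part_sub nu la]) => [nu []//|].
have -> : [set nu | part_sub nu la] =
    diagram @^-1` [set` fpowerset (diagram la)].
  by apply/seteqP; split=> nu; rewrite /preimage /= fpowersetE.
apply: finite_preimage; last exact: finite_fset.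
by move=> nu1 nu2 _ _; exact: diagram_inj.
Qed.

Definition skew (la mu : intpart) : {fset nat * nat} :=
  (diagram la `\` diagram mu)%fset.

Definition right_of (c : nat * nat) : nat * nat := (c.1, c.2.+1).
Definition below (c : nat * nat) : nat * nat := (c.1.+1, c.2).

Definition content (c : nat * nat) : int := c.2%:Z - c.1%:Z.

Definition tableau (la mu : intpart) : Type := {ffun skew la mu -> nat}.

HB.instance Definition _ (la mu : intpart) :=
  Choice.copy (tableau la mu) {ffun skew la mu -> nat}.

Section Tableaux.
Variables (n : nat) (la mu : intpart).
Implicit Types (T : tableau la mu) (c d : skew la mu).

Definition lh_ratio T c : rat := (T c)%:R / (n%:Z + content (val c))%:~R.

Definition LHT : set (tableau la mu) := [set T |
  (forall c d, val d = right_of (val c) -> lh_ratio T d <= lh_ratio T c) /\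
  (forall c d, val d = below (val c) -> lh_ratio T d < lh_ratio T c)].

(* The ratios are nonnegative when [size la <= n], so that [Num.truncn] is the
   floor. *)
Definition floor_tableau T : tableau la mu :=
  [ffun c => Num.truncn (lh_ratio T c)].

Definition SSCT : set (tableau la mu) := [set T |
  [/\ forall c d, val d = right_of (val c) -> (T d <= T c)%N,
      forall c d, val d = below (val c) -> (T d < T c)%N
    & forall c, (T c)%:Z < n%:Z + content (val c)]].

Variables (R : comNzRingType) (V : choiceType).

(* The product of [z (T c)] over the cells: [x^T] for a sequence [x] of
   variables, and its image when the variables are replaced by series. *)
Definition tab_weight (z : nat -> fps R V) T : fps R V :=
  \prod_(c : skew la mu) z (T c).

Definition Lgf (z : nat -> fps R V) : fps R V :=
  fps_sum LHT (fun T => tab_weight z (floor_tableau T)).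

Definition Sgf (z : nat -> fps R V) : fps R V :=
  \sum_(T \in SSCT) tab_weight z T.

End Tableaux.

Arguments LHT : clear implicits.
Arguments SSCT : clear implicits.

Definition xvar (R : comNzRingType) (k : nat) : fps R (nat + nat)%type :=
  fpsX R (inl k).
Definition yvar (R : comNzRingType) (k : nat) : fps R (nat + nat)%type :=
  fpsX R (inr k).

(* The remaining lemmas, with [part_interval_finite], show that every sum in the
   generating functions has finite support in each coefficient. *)

Lemma fps_mul_neq0 (R : comNzRingType) (V : choiceType) (f g : fps R V) m :
  (f * g) m <> 0 -> exists p, [/\ p.1 `+` p.2 = m, f p.1 <> 0 & g p.2 <> 0].
Proof.
move=> fg_neq0; apply: contrapT => /forallNP no_p; apply: fg_neq0.
rewrite [LHS]/(fps_mul f g m) /fps_mul fsbig1 // => p /= pm.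
have [->|/eqP fp] := eqVneq (f p.1) 0; first exact: mul0r.
have [->|/eqP gp] := eqVneq (g p.2) 0; first exact: mulr0.
by case: (no_p p).
Qed.

Lemma fpsX_neq0 (R : comNzRingType) (V : choiceType) (v : V) m :
  fpsX R v m <> 0 -> m = [mset v].
Proof. by rewrite /fpsX; case: eqP. Qed.

Lemma xvar_summable (R : comNzRingType) : fps_summable setT (xvar R).
Proof.
move=> m; have [[k0 mk0]|no_k] := pselect (exists k, m = [mset inl k]).
  apply: sub_finite_set (finite_set1 k0) => k /= [_ Xk].
  have mk := fpsX_neq0 Xk.
  have : inl k \in [mset (inl k0 : nat + nat)] by rewrite -mk0 mk in_mset1.
  by rewrite in_mset1 => /eqP[].
apply: sub_finite_set (@finite_set0 _) => k /= [_ Xk].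
by apply: no_k; exists k; exact: fpsX_neq0 Xk.
Qed.

Lemma prod_xvar_neq0 (R : comNzRingType) (I : eqType) (r : seq I)
    (F : I -> nat) m :
  (\prod_(i <- r) xvar R (F i)) m <> 0 -> {in r, forall i, inl (F i) \in m}.
Proof.
elim: r m => [//|i r IH] m; rewrite big_cons => /fps_mul_neq0[[a b] /=].
move=> [<- Xa /IH br] j; rewrite (fpsX_neq0 Xa) inE => /predU1P[->|/br jb].
  by rewrite in_msetD in_mset1 eqxx.
by rewrite in_msetD jb orbT.
Qed.

Section Finiteness.
Variables (n : nat) (la mu : intpart).
Hypothesis size_la : (size la <= n)%N.

Lemma content_gt0 (c : skew la mu) : 0 < n%:Z + content (val c).
Proof.
case: c => -[i j] /= /fsetDP[+ _]; rewrite in_diagram => /andP[].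
move=> /andP[_ ila] /andP[j0 _]; rewrite /content /= addrCA ltr_wpDr ?ltz_nat //.
by rewrite subr_ge0 lez_nat (leq_trans ila).
Qed.

Lemma bounded_tableaux_finite (K : nat) :
  finite_set [set T : tableau la mu | forall c, (T c < K)%N].
Proof.
pose G (F : {ffun skew la mu -> 'I_K}) : tableau la mu := [ffun c => F c : nat].
apply: (@sub_finite_set _ _ (G @` setT)); last exact/finite_image/finite_finset.
move=> T /= TK; exists [ffun c => Ordinal (TK c)] => //.
by apply/ffunP => c; rewrite !ffunE.
Qed.

Let entry_bound : exists K : nat, forall c : skew la mu,
  n%:Z + content (val c) <= K%:Z.
Proof.
exists (\max_(c : skew la mu) absz (n%:Z + content (val c))%R) => c.
rewrite -[X in X <= _]gez0_abs ?(ltW (content_gt0 _)) // lez_nat.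
exact: (leq_bigmax c).
Qed.

Lemma SSCT_finite : finite_set (SSCT n la mu).
Proof.
have [K leK] := entry_bound.
apply: sub_finite_set (bounded_tableaux_finite K) => T [_ _ ltT] c.
by rewrite -ltz_nat (lt_le_trans (ltT c)).
Qed.

Lemma LHT_summable (R : comNzRingType) : fps_summable (LHT n la mu)
  (fun T => tab_weight (xvar R) (floor_tableau n T)).
Proof.
move=> m; have [K leK] := entry_bound.
pose B := \max_(v : finsupp m) (if val v is inl k then k else 0%N).
apply: sub_finite_set (bounded_tableaux_finite (B.+1 * K)%N) => T /= [_ Tm] c.
have kT : inl (floor_tableau n T c) \in finsupp m.
  rewrite msuppE.
  exact: (@prod_xvar_neq0 _ _ _ (floor_tableau n T) _ Tm c (mem_index_enum _)).
have : (floor_tableau n T c <= B)%N by exact: (leq_bigmax [` kT]%fset).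
have gt0 : 0 < (n%:Z + content (val c))%:~R :> rat by rewrite ltr0z content_gt0.
rewrite ffunE truncn_le_nat /lh_ratio ltr_pdivrMr // !pmulrn -intrM ltr_int.
move=> /lt_le_trans ltT; rewrite -ltz_nat ltT // PoszM.
exact: ler_wpM2l.
Qed.

End Finiteness.

(* Main.v *)
Require Import Defs.
From mathcomp Require Import all_boot all_order all_algebra finmap multiset.
From mathcomp Require Import boolp classical_sets functions cardinality fsbigop.
From mathcomp Require Import zify.

(** Place the rows of a partition [la] with at most [n] rows at the positions
    [beta n la i]: they strictly decrease with [i], and a cell whose content is
    [k - n] moves one of them from [k - 1] to [k].  A family [N] of row vectors
    indexed by positions gives the minor [minor N la], the determinant of the
    rows of [N] at the positions of [la].

    The two generating functions are instances of one sum, [ssyt_sum]: fillings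
    by numbers, weakly decreasing along rows and strictly decreasing down
    columns, where the value [e] in a cell of content [k - n] has weight
    [w e k].  Such a filling adds cells to the inner shape one at a time, by
    decreasing value and, for equal values, from left to right.  Adding a cell
    of content [k - n] is dual to the row operation that adds [w e k] times row
    [k - 1] of [N] to row [k]: expanding the minor of [la] along that operation
    gives the minor of [la] and the one of [la] without the cell, the second
    being zero, with two equal rows, when the cell is not removable.  Hence
    ([ssyt_sum_minor]) the sum over [nu] of the tableau sum of [la / nu] times
    [minor N nu] is the minor at [la] of a transform of [N], and only a
    computation on single rows is left.

    For semistandard [n]-content tableaux the weight is [z e] if [e < k] and
    zero otherwise.  The transform sends [N] to the family whose entry [a] is
    the entry 0 of [D ^ a N], where [D N b = N (b + 1) + z b N b]
    ([rows_from_newton]); this is Newton interpolation at the nodes [z].  When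
    all nodes are shifted by [X], [D] becomes [D + X], so the transform for
    [X + y] is the transform for [y] followed by the one for the constant nodes
    [X] ([newton_rows_shift]).

    A lecture hall entry [L] in a cell of content [k - n] is determined by its
    quotient [q] and remainder [r] modulo [k].  The lecture hall inequalities
    say exactly that the pairs [(q, r)], ordered lexicographically, decrease
    weakly along rows and strictly down columns ([lh_code_le]), and the weight
    sees only [q].  So for each [q] the tableaux run through the content
    condition [r < k] with constant nodes [x q], and the composite transform
    has constant nodes the sum of the [x q] ([rows_from_blocks]).

    Apply this to [N] the transform, with nodes [y], of rows whose minors are
    the indicator function of [mu]: the minors of [N] are then the sums over
    content tableaux of [nu / mu], and both sides of the theorem are minors of
    the same family.  This settles the case of finitely many variables [x].  A
    given coefficient involves only finitely many of them, and the comparison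
    of series on monomials in the first [Q] variables is compatible with sums
    and products. *)

Set Implicit Arguments.
Unset Strict Implicit.
Unset Printing Implicit Defensive.

Import Order.TTheory GRing.Theory Num.Theory.

Local Open Scope classical_set_scope.
Local Open Scope ring_scope.

(* The name also denotes a class of bilinear forms. *)
Local Notation skew := Defs.skew.

(** * Rows of partitions *)

(** Rows are numbered from 0, whereas cells are numbered from 1. *)
Definition prow (la : intpart) (i : nat) : nat := nth 0%N la i.

Lemma prow_le (la : intpart) i : (prow la i.+1 <= prow la i)%N.
Proof.
rewrite /prow; case: la => s /= /andP[sorted_s _].
have [lt_i|le_i] := ltnP i.+1 (size s); last by rewrite nth_default.
have := @sorted_leq_nth _ geq _ _ 0%N _ sorted_s i i.+1.
rewrite !inE lt_i (ltnW lt_i) leqnSn; apply=> //.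
- by move=> a b c /= ab bc; apply: leq_trans bc ab.
- by move=> a /=; apply: leqnn.
Qed.

Lemma prow_anti (la : intpart) i j : (i <= j)%N -> (prow la j <= prow la i)%N.
Proof.
move=> /subnK <-; elim: (j - i)%N => [//|d IH].
by rewrite addSn (leq_trans (prow_le _ _)).
Qed.

Lemma prow_ge_size (la : intpart) i : (size la <= i)%N -> prow la i = 0%N.
Proof. exact: nth_default. Qed.

Lemma mem_diagram (la : intpart) i j :
  ((i, j) \in diagram la) = (0 < i)%N && (0 < j <= prow la i.-1)%N.
Proof.
rewrite in_diagram -/(prow la _); case: i => [//|i] /=.
case: (ltnP i) => //= /prow_ge_size ->.
by case: j.
Qed.

Lemma part_subP (mu la : intpart) :
  reflect (forall i, (prow mu i <= prow la i)%N) (part_sub mu la).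
Proof.
rewrite /part_sub; apply: (iffP (@fsubsetP _ (diagram mu) (diagram la))) => [sub i|le_r [i j]].
- case E: (prow mu i) => [//|j].
  have := sub (i.+1, j.+1); rewrite !mem_diagram /= E leqnn => /(_ isT) //.
- rewrite !mem_diagram => /and3P[-> -> /=] /leq_trans; exact.
Qed.

Lemma part_sub_refl (la : intpart) : part_sub la la.
Proof. exact: fsubset_refl. Qed.

Lemma part_sub_trans (mu nu la : intpart) :
  part_sub mu nu -> part_sub nu la -> part_sub mu la.
Proof. exact: fsubset_trans. Qed.

Lemma part_sub_size (mu la : intpart) n :
  part_sub mu la -> (size la <= n)%N -> (size mu <= n)%N.
Proof.
move=> /part_subP le_r le_n; apply: leq_trans le_n; rewrite leqNgt.
apply/negP => lt_s; move: (le_r (size la)); rewrite (prow_ge_size (leqnn _)).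
rewrite leqn0 => /eqP E; have := mem_nth 0%N lt_s; rewrite -/(prow mu _) E.
by have /andP[_ /negPf ->] := valP mu.
Qed.

Lemma prow_inj (la mu : intpart) : prow la =1 prow mu -> la = mu.
Proof.
by move=> E; apply: diagram_inj; apply/fsetP => -[i j]; rewrite !mem_diagram E.
Qed.

Lemma prow_surj (l : nat -> nat) n :
    (forall i, (l i.+1 <= l i)%N) -> l n = 0%N ->
  exists la : intpart, prow la =1 l.
Proof.
move=> l_le l0.
have l_anti i j : (i <= j)%N -> (l j <= l i)%N.
  move=> /subnK <-; elim: (j - i)%N => [//|d IH].
  by rewrite addSn (leq_trans (l_le _)).
have ex0 : exists m, l m == 0%N by exists n; rewrite l0.
(* The smallest zero of [l] is the number of positive parts. *)
case: (ex_minnP ex0) => m /eqP lm m_min.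
have part_l : sorted geq (mkseq l m) && (0%N \notin mkseq l m).
  apply/andP; split.
    apply: (@homo_sorted _ _ l leq geq l_anti); exact: iota_sorted.
  apply/mapP => -[i]; rewrite mem_iota /= => lt_im /esym/eqP /m_min.
  by rewrite leqNgt lt_im.
exists (IntPart part_l) => i; rewrite /prow /=.
have [lt_im|le_mi] := ltnP i m; first by rewrite nth_mkseq.
rewrite nth_default ?size_mkseq //; apply/esym/eqP.
by rewrite -leqn0 -lm l_anti.
Qed.

Definition remove_box (la : intpart) i (la' : intpart) : Prop :=
  [/\ (prow la i.+1 < prow la i)%N, prow la' i = (prow la i).-1
    & forall j, j != i -> prow la' j = prow la j].

Lemma remove_box_ex (la : intpart) i :
  (prow la i.+1 < prow la i)%N -> exists la', remove_box la i la'.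
Proof.
move=> cor.
have [||la' E] := @prow_surj (fun j => if j == i then (prow la i).-1 else prow la j)
  (maxn (size la) i.+1).
- move=> j /=; have := prow_le la j.
  case: eqP => E1; case: eqP => E2 //; subst; lia.
- rewrite ifF; last by apply/negbTE; rewrite neq_ltn leq_max leqnn !orbT.
  by rewrite prow_ge_size // leq_maxl.
exists la'; split=> // [|j /negPf ji]; by rewrite E ?eqxx ?ji.
Qed.

Lemma remove_box_diagram (la : intpart) i (la' : intpart) :
  remove_box la i la' ->
  diagram la' = (diagram la `\ (i.+1, prow la i))%fset.
Proof.
move=> [cor Ei Ej]; apply/fsetP => -[a b]; rewrite in_fsetD1 !mem_diagram.
case: a => [|a] /=; first by [].
have [->|ai] := eqVneq a i; last first.
  rewrite Ej //; suff -> : ((a.+1, b) != (i.+1, prow la i)) by [].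
  by apply: contra ai => /eqP[-> _].
rewrite Ei; have -> : ((i.+1, b) != (i.+1, prow la i)) = (b != prow la i).
  by rewrite xpair_eqE eqxx.
by apply/idP/idP; lia.
Qed.

Lemma remove_box_sub (la : intpart) i (la' : intpart) :
  remove_box la i la' -> part_sub la' la.
Proof. by rewrite /part_sub => /remove_box_diagram ->; exact: fsubD1set. Qed.

(** The beta-numbers of [la].  When row [i] is nonempty, [beta n la i] is [n]
    plus the content of its last cell. *)
Definition beta n (la : intpart) i : nat := (prow la i + (n - i.+1))%N.

Lemma beta_lt n la i j : (i < j < n)%N -> (beta n la j < beta n la i)%N.
Proof.
move=> /andP[ij jn]; rewrite /beta.
by have := prow_anti la (ltnW ij); lia.
Qed.

Lemma beta_inj n la i j :
  (i < n)%N -> (j < n)%N -> beta n la i = beta n la j -> i = j.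
Proof.
move=> li lj E; have [ij|ij|//] := ltngtP i j.
- by have := @beta_lt n la i j; rewrite ij lj E ltnn => /(_ isT).
- by have := @beta_lt n la j i; rewrite ij li E ltnn => /(_ isT).
Qed.

(** * Minors and row operations *)

Section Minors.
Variables (R : comNzRingType) (n : nat).
Implicit Types (N : nat -> 'rV[R]_n) (la mu : intpart).

Definition minor N la : R := \det (\matrix_(i < n) N (beta n la i)).

Lemma eq_minor N N' la :
  (forall i, (i < n)%N -> N (beta n la i) = N' (beta n la i)) ->
  minor N la = minor N' la.
Proof. by move=> E; congr (\det _); apply/row_matrixP => i; rewrite !rowK E. Qed.

(** Row 0 is left alone because no cell has content [- n] in a partition with at
    most [n] rows. *)
Definition row_step (x : R) k N : nat -> 'rV[R]_n :=
  fun a => if (a == k) && (0 < k)%N then N a + x *: N a.-1 else N a.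

(** The beta-numbers are distinct, so at most one row of the matrix changes, and
    the determinant is linear in it. *)
Lemma minor_row_step x k N la i : (i < n)%N -> beta n la i = k -> (0 < k)%N ->
  minor (row_step x k N) la = minor N la + x *
    \det (\matrix_(j < n) N (if j == i :> nat then k.-1 else beta n la j)).
Proof.
move=> lt_in Ek k0; rewrite /minor.
pose o := Ordinal lt_in.
have Eo : beta n la o = k := Ek.
have oi : o == i :> nat by exact: eqxx.
have liftP j : (lift o j != i :> nat) && (beta n la (lift o j) != k).
  have ji : lift o j != i :> nat by have := neq_lift o j; rewrite eq_sym.
  rewrite ji /=; apply: contra ji; rewrite -Eo => /eqP E.
  by apply/eqP/(@beta_inj n la).
rewrite -[X in X + _]mul1r.
apply: (@determinant_multilinear _ _ _ _ _ o).
- by rewrite !rowK /row_step Eo oi eqxx k0 scale1r.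
- apply/matrixP => j c; have /andP[_ /negPf jk] := liftP j.
  by rewrite !mxE /row_step jk.
- apply/matrixP => j c; have /andP[/negPf ji /negPf jk] := liftP j.
  by rewrite !mxE /row_step jk ji.
Qed.

Lemma minor_row_step_remove x k N la i la' :
    (size la <= n)%N -> (i < n)%N -> beta n la i = k -> remove_box la i la' ->
  minor (row_step x k N) la = minor N la + x * minor N la'.
Proof.
move=> le_n lt_in Ek [cor Ei Ej].
rewrite (minor_row_step _ _ lt_in Ek); last by move: Ek; rewrite /beta; lia.
congr (_ + x * \det _); apply/row_matrixP => j; rewrite !rowK; congr N.
have [ji|ji] := eqVneq (val j) i; last by rewrite /beta Ej.
by rewrite /beta ji Ei -Ek /beta; lia.
Qed.

(** If the row at position [k] ends above a row of the same length, that next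
    row sits at [k - 1] and the correcting determinant has two equal rows. *)
Lemma minor_row_step_id x k N la : (size la <= n)%N ->
    (forall i, (i < n)%N -> beta n la i = k -> prow la i.+1 = prow la i) ->
  minor (row_step x k N) la = minor N la.
Proof.
move=> le_n nocor.
have [k0|k0] := posnP k.
  by apply: eq_minor => i _; rewrite /row_step k0 andbF.
have [[i [lt_in Ek]]|noi] := pselect (exists i, (i < n)%N /\ beta n la i = k);
    last first.
  apply: eq_minor => i lt_in; rewrite /row_step; case: eqP => //= E.
  by case: noi; exists i.
rewrite (minor_row_step _ _ lt_in Ek k0).
have Er := nocor _ lt_in Ek.
have lt_i1n : (i.+1 < n)%N.
  rewrite ltnNge; apply/negP => le_ni; move: Er k0.
  rewrite prow_ge_size ?(leq_trans le_n) // -Ek /beta => <-; lia.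
rewrite (@determinant_alternate _ _ _ (Ordinal lt_in) (Ordinal lt_i1n)).
- by rewrite mulr0 addr0.
- by rewrite -val_eqE /= neq_ltn leqnn.
move=> j; rewrite !mxE /= eqxx ifF; last by lia.
by congr (N _ 0 j); rewrite -Ek /beta Er; lia.
Qed.

Definition unit_rows (mu : intpart) : nat -> 'rV[R]_n :=
  fun a => \row_(j < n) (a == beta n mu j)%:R.

(** Where the strictly decreasing sequences of beta-numbers first differ, the
    larger of the two entries is missing from the other sequence, and the matrix
    has a zero row or a zero column. *)
Lemma minor_unit_rows (mu la : intpart) : (size mu <= n)%N -> (size la <= n)%N ->
  minor (unit_rows mu) la = (la == mu)%:R.
Proof.
move=> size_mu size_la; rewrite /minor; have [->|neq] := eqVneq la mu.
  rewrite -[RHS](det1 _ n); congr (\det _); apply/matrixP => i j; rewrite !mxE.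
  congr ((nat_of_bool _)%:R); apply/eqP/eqP => [E|-> //].
  by apply: val_inj; apply: (@beta_inj n mu) => //=; apply: ltn_ord.
have ex_neq : exists i, prow la i != prow mu i.
  apply: contrapT => no; move/eqP: neq; apply; apply: prow_inj => i.
  by apply/eqP/negPn/negP => ni; apply: no; exists i.
case: (ex_minnP ex_neq) => i ni min_i.
have lt_in : (i < n)%N.
  rewrite ltnNge; apply/negP => le_ni; move: ni.
  by rewrite !prow_ge_size ?eqxx // (leq_trans _ le_ni).
have eq_lt j : (j < i)%N -> beta n la j = beta n mu j.
  move=> ji; rewrite /beta; congr (_ + _)%N; apply/eqP/negPn/negP => /min_i.
  by rewrite leqNgt ji.
have nbeta : beta n la i != beta n mu i by rewrite /beta; move/eqP: ni; lia.
have [lt|lt|/eqP] := ltngtP (beta n la i) (beta n mu i); last first.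
- by rewrite (negPf nbeta).
- rewrite (expand_det_row _ (Ordinal lt_in)) big1 // => j _; rewrite !mxE.
  case: eqP => [E0|_]; last by rewrite mul0r.
  have E : beta n la i = beta n mu j := E0.
  have [ij|ji|ij] := ltngtP i j.
  + by have := @beta_lt n mu i j; rewrite ij ltn_ord -E => /(_ isT); lia.
  + by have := @beta_lt n la j i; rewrite ji lt_in (eq_lt _ ji) E ltnn => /(_ isT).
  + by exfalso; move: lt; rewrite E ij ltnn.
- rewrite (expand_det_col _ (Ordinal lt_in)) big1 // => j _; rewrite !mxE.
  case: eqP => [E0|_]; last by rewrite mul0r.
  have E : beta n la j = beta n mu i := E0.
  have [ij|ji|ij] := ltngtP i j.
  + by have := @beta_lt n la i j; rewrite ij ltn_ord E => /(_ isT); lia.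
  + by have := @beta_lt n mu j i; rewrite ji lt_in -(eq_lt _ ji) E ltnn => /(_ isT).
  + by exfalso; move: lt; rewrite -E ij ltnn.
Qed.

End Minors.

(** * Transforms of families of rows *)

Section RowOperators.
Variables (R : comNzRingType) (n : nat).
Implicit Types (N : nat -> 'rV[R]_n) (w : nat -> nat -> R) (z : nat -> R).

(** The cells holding one value are added in the order of increasing content;
    this is the composite of the row operations of the first [K] contents. *)
Fixpoint box_rows z N K : nat -> 'rV[R]_n :=
  if K is k.+1 then row_step (z k) k (box_rows z N k) else N.

(** Closed form of all the row operations for one value: row [b + 1] receives a
    multiple of row [b] that has already been updated. *)
Fixpoint strip_rows z N (a : nat) : 'rV[R]_n :=
  if a is b.+1 then N a + z a *: strip_rows z N b else N 0%N.

Lemma box_rowsE z N K a :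
  box_rows z N K a = if (a < K)%N then strip_rows z N a else N a.
Proof.
elim: K a => [//|K IH] a /=; rewrite /row_step !IH ltnS.
case: (ltngtP a K) => [//|//|->] /=.
by case: K {IH} => [//|K]; rewrite leqnn.
Qed.

(** The values [v], ..., [v + d - 1]; the largest value acts first, being
    innermost in a tableau. *)
Fixpoint rows_from w d v N : nat -> 'rV[R]_n :=
  if d is e.+1 then strip_rows (w v) (rows_from w e v.+1 N) else N.

Lemma rows_from_cat w d e v N :
  rows_from w (d + e) v N = rows_from w d v (rows_from w e (v + d) N).
Proof.
by elim: d v => [|d IH] v /=; rewrite ?addn0 // IH addSnnS.
Qed.

Definition newton_op z N (b : nat) : 'rV[R]_n := N b.+1 + z b *: N b.

(** Expansion in the Newton basis: if [N b] stands for the polynomial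
    [(t - z 0) ... (t - z (b - 1))], then [newton_op] is multiplication by [t],
    and [newton_rows z N a] is [t ^ a]. *)
Definition newton_rows z N (a : nat) : 'rV[R]_n := iter a (newton_op z) N 0%N.

Lemma iter_newton_opD z x N N' c b :
  iter c (newton_op z) (fun a => N a + x *: N' a) b =
  iter c (newton_op z) N b + x *: iter c (newton_op z) N' b.
Proof.
elim: c b => [//|c IH] b; rewrite !iterS /newton_op !IH.
by rewrite !scalerDr !scalerA [x * _]mulrC addrACA.
Qed.

(** Shifting the nodes by [x] adds the scalar [x] to [newton_op z], so the two
    operators commute.  The operator with constant nodes [x] acts on the
    sequence [a |-> (newton_op z) ^ a N 0] as [newton_op z + x] acts on [N]. *)
Lemma newton_rows_shift x z N :
  newton_rows (fun k => x + z k) N =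
  newton_rows (fun=> x) (newton_rows z N).
Proof.
apply/funext => a; rewrite /newton_rows.
elim: a N => [//|a IH] N; rewrite !iterSr IH; congr (iter a _ _ _).
apply/funext => c; rewrite [RHS]/newton_op iterSr -iter_newton_opD.
symmetry; congr (iter c _ _ _); apply/funext => b.
by rewrite /newton_op scalerDl -addrA [z b *: _ + _]addrC.
Qed.

Lemma eq_newton_rows z N N' a :
  (forall b, (b <= a)%N -> N b = N' b) -> newton_rows z N a = newton_rows z N' a.
Proof.
rewrite /newton_rows => E.
suff gen c : (c <= a)%N -> forall b, (b + c <= a)%N ->
    iter c (newton_op z) N b = iter c (newton_op z) N' b by exact: gen.
elim: c => [|c IH] ca b bca; first by apply: E; rewrite addn0 in bca.
by rewrite !iterS /newton_op !IH //; lia.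
Qed.

Lemma newton_rows0 N : newton_rows (fun=> 0) N = N.
Proof.
apply/funext => a; rewrite /newton_rows.
have E c b : iter c (newton_op (fun=> 0)) N b = N (b + c)%N.
  elim: c b => [|c IH] b; first by rewrite addn0.
  by rewrite iterS /newton_op !IH scale0r addr0 addSnnS.
by rewrite E.
Qed.

(** Value [v] affects only the positions above [v].  By downward induction on
    [v], the values from [v] on turn row [a > v] into entry [v] of the iterate
    of order [a - v]: the recursion of [strip_rows] in [a] is the definition of
    [newton_op] at [v]. *)
Lemma rows_from_newton w z v0 B N a :
    (forall u k, (u < B)%N -> w (v0 + u)%N k = if (u < k)%N then z u else 0) ->
  (a <= B)%N -> rows_from w B v0 N a = newton_rows z N a.
Proof.
move=> wE.
suff gen d v : (v + d)%N = B -> forall a, (a <= B)%N ->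
    rows_from w d (v0 + v) N a =
    if (a <= v)%N then N a else iter (a - v) (newton_op z) N v.
  move=> aB; have := gen B 0%N (add0n B) _ aB; rewrite addn0 => ->.
  by rewrite subn0; case: (a).
elim: d v => [|d IH] v vd {a}.
  by move=> a aB /=; rewrite ifT // -[v]addn0 vd.
have IHv : forall a, (a <= B)%N -> rows_from w d (v0 + v).+1 N a =
    if (a <= v.+1)%N then N a else iter (a - v.+1) (newton_op z) N v.+1.
  by move=> a; rewrite -addnS; apply: IH; lia.
elim=> [|a IHa] aB; first by rewrite /= IHv.
have -> : rows_from w d.+1 (v0 + v) N a.+1 = rows_from w d (v0 + v).+1 N a.+1 +
    w (v0 + v)%N a.+1 *: rows_from w d.+1 (v0 + v) N a by [].
rewrite IHv // wE; last by lia.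
rewrite IHa ?(ltnW aB) // !ltnS.
have [lt|lt|->] := ltngtP a v.
- by rewrite scale0r addr0.
- by rewrite subSS subSn // ltnW.
- by rewrite subSn // subnn.
Qed.

(** Each block of [B] consecutive values has constant nodes, and constant nodes
    add up under composition by [newton_rows_shift]. *)
Lemma rows_from_blocks w z B q0 Q N a :
    (forall u k, w u k = if (u %% B < k)%N then z (u %/ B)%N else 0) ->
  (a <= B)%N -> rows_from w (Q * B) (q0 * B) N a =
    newton_rows (fun=> \sum_(q < Q) z (q0 + q)%N) N a.
Proof.
move=> wE; elim: Q q0 a => [|Q IH] q0 a aB.
  by rewrite mul0n big_ord0 newton_rows0.
rewrite mulSn rows_from_cat (@rows_from_newton _ (fun=> z q0) _ B) //; last first.
  move=> u k uB; have B0 : (0 < B)%N by lia.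
  by rewrite wE modnMDl modn_small // divnMDl // divn_small // addn0.
rewrite big_ord_recl addn0 newton_rows_shift; apply: eq_newton_rows => b ba.
rewrite addnC -mulSn IH ?(leq_trans ba) //.
congr (newton_rows _ _ _); apply/funext => _; apply: eq_bigr => q _.
by rewrite addSnnS.
Qed.

End RowOperators.

(** * Tableaux built one cell at a time *)

Definition diag_index n (c : nat * nat) : nat := (n + c.2 - c.1)%N.

Lemma diag_index_last n la i : (i < n)%N -> (0 < prow la i)%N ->
  diag_index n (i.+1, prow la i) = beta n la i.
Proof. by rewrite /diag_index /beta /=; lia. Qed.

Lemma mem_diagram_row (la : intpart) c : c \in diagram la ->
  exists i j, [/\ c = (i.+1, j.+1), (j < prow la i)%N & (i < size la)%N].
Proof.
case: c => a b; rewrite mem_diagram => /andP[].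
case: a b => [//|i] [//|j] _ /= lt_j; exists i, j; split=> //.
by rewrite ltnNge; apply/negP => /prow_ge_size E; rewrite E in lt_j.
Qed.

Lemma in_skew (la mu : intpart) (c : nat * nat) :
  (c \in skew la mu) = (c \notin diagram mu) && (c \in diagram la).
Proof. by rewrite /skew in_fsetD. Qed.

Lemma diagram_left (la : intpart) i j :
  (i.+1, j.+2) \in diagram la -> (i.+1, j.+1) \in diagram la.
Proof. by rewrite !mem_diagram /= => /ltnW. Qed.

Lemma diagram_above (la : intpart) i j :
  (i.+2, j.+1) \in diagram la -> (i.+1, j.+1) \in diagram la.
Proof. by rewrite !mem_diagram /= => /leq_trans; apply; exact: prow_le. Qed.

Section TableauSums.
Variables (R : comNzRingType) (n : nat) (D : {fset nat * nat}) (M : nat).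
Variable w : nat -> nat -> R.
Implicit Types (la nu : intpart) (T : {ffun D -> 'I_M.+1}) (c d : D).

(** A stage of the construction of a tableau: only values above [v], or equal to
    [v] in cells of diagonal below [K], have been placed.  The cells of all the
    shapes met in an induction lie in the fixed set [D], and a filling is [0]
    outside its shape, so that fillings of different shapes have one type. *)
Definition ssyt v K la nu T : Prop :=
  [/\ part_sub nu la,
      forall c, val c \notin skew la nu -> T c = ord0,
      forall c d, val c \in skew la nu -> val d \in skew la nu ->
        val d = right_of (val c) -> (T d <= T c)%N,
      forall c d, val c \in skew la nu -> val d \in skew la nu ->
        val d = below (val c) -> (T d < T c)%N
    & forall c, val c \in skew la nu ->
        (v < T c)%N || (T c == v :> nat) && (diag_index n (val c) < K)%N].

Definition ssyt_sum v K la nu : R :=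
  \sum_(T | `[< ssyt v K la nu T >])
    \prod_(c | val c \in skew la nu) w (T c) (diag_index n (val c)).

(** The cell placed last is the end of its row and of its column: its right and
    lower neighbours would have to be placed later. *)
Lemma ssyt_corner v K la nu T c : (size la <= n)%N ->
    (diagram la `<=` D)%fset -> ssyt v K.+1 la nu T ->
    val c \in skew la nu -> T c = v :> nat -> diag_index n (val c) = K ->
  exists i, [/\ val c = (i.+1, prow la i), (i < n)%N, beta n la i = K
              & (prow la i.+1 < prow la i)%N].
Proof.
move=> size_la /fsubsetP laD [_ _ Tr Tb Tv] cS Tc dc.
move: (cS); rewrite in_skew => /andP[c_nu].
case/mem_diagram_row => i [j [Ec lt_j lt_i]].
have lt_in : (i < n)%N := leq_trans lt_i size_la.
have Ej : j.+1 = prow la i.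
  apply/eqP; rewrite eqn_leq lt_j /= leqNgt; apply/negP => lt_j2.
  have dla : (i.+1, j.+2) \in diagram la by rewrite mem_diagram.
  have dS : (i.+1, j.+2) \in skew la nu.
    rewrite in_skew dla andbT; apply: contra c_nu; rewrite Ec.
    exact: diagram_left.
  have := Tv [` laD _ dla]%fset dS; have := Tr c [` laD _ dla]%fset cS dS.
  rewrite Tc /= Ec => /(_ erefl) le_v /orP[|/andP[_]]; first by rewrite ltnNge le_v.
  by move: dc; rewrite Ec /diag_index /=; lia.
have dE : diag_index n (val c) = beta n la i.
  by rewrite Ec Ej diag_index_last // -Ej.
exists i; split=> //; first by rewrite Ec Ej.
  by rewrite -dE.
rewrite -Ej ltnS leqNgt; apply/negP => lt_j1.
have dla : (i.+2, j.+1) \in diagram la by rewrite mem_diagram.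
have dS : (i.+2, j.+1) \in skew la nu.
  rewrite in_skew dla andbT; apply: contra c_nu; rewrite Ec.
  exact: diagram_above.
have := Tv [` laD _ dla]%fset dS; have := Tb c [` laD _ dla]%fset cS dS.
rewrite Tc /= Ec => /(_ erefl) lt_v /orP[|/andP[/eqP E _]].
  by rewrite ltnNge ltnW.
by rewrite E ltnn in lt_v.
Qed.

Lemma ssyt_sum_step_id v K la nu : (size la <= n)%N ->
    (diagram la `<=` D)%fset ->
    (forall i, (i < n)%N -> beta n la i = K -> prow la i.+1 = prow la i) ->
  ssyt_sum v K.+1 la nu = ssyt_sum v K la nu.
Proof.
move=> size_la laD nocor; apply: eq_bigl => T; apply: asbool_equiv_eq.
split=> -[sub T0 Tr Tb Tv]; split=> // c cS; last first.
  by case/orP: (Tv c cS) => [->//|/andP[-> /=]]; rewrite orbC => /leqW ->.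
have := Tv c cS; case/orP => [->//|/andP[/eqP Tc]]; rewrite Tc eqxx ltnn /=.
rewrite ltnS leq_eqVlt => /orP[/eqP dc|//].
have [i [_ lt_in Ei]] := @ssyt_corner v K la nu T c size_la laD
  (And5 sub T0 Tr Tb Tv) cS Tc dc.
by rewrite (nocor i) // ltnn.
Qed.

(** Fillings are split according to whether the corner on diagonal [K] holds
    [v]; erasing that entry is a bijection with the fillings of the smaller
    shape at the previous stage. *)
Lemma ssyt_sum_step_remove v K la nu i la' : (v <= M)%N -> (size la <= n)%N ->
    (diagram la `<=` D)%fset ->
    (i < n)%N -> beta n la i = K -> remove_box la i la' ->
  ssyt_sum v K.+1 la nu = ssyt_sum v K la nu + w v K * ssyt_sum v K la' nu.
Proof.
move=> le_vM size_la laD lt_in Ei rem; have [cor _ _] := rem.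
have Ela' := remove_box_diagram rem.
have r0 : (0 < prow la i)%N by apply: leq_ltn_trans cor.
have x_la : (i.+1, prow la i) \in diagram la by rewrite mem_diagram /= r0 leqnn.
have [x vx] : exists x : D, val x = (i.+1, prow la i).
  by exists [` fsubsetP laD _ x_la]%fset.
have dx : diag_index n (val x) = K by rewrite vx diag_index_last.
(* The second half of the split is the sum at stage [K] for the same shape. *)
rewrite /ssyt_sum (bigID (fun T => (val x \in skew la nu) && (T x == v :> nat))) /=.
rewrite addrC; congr (_ + _).
  apply: eq_bigl => T; apply/andP/asboolP => [[/asboolP ST nx]|ST].
    have [sub T0 Tr Tb Tv] := ST; split=> // c cS.
    have := Tv c cS; case/orP => [->//|/andP[/eqP Tc]]; rewrite Tc eqxx ltnn /=.
    rewrite ltnS leq_eqVlt => /orP[/eqP dc|//].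
    have [j [Ec lt_jn Ej _]] := ssyt_corner size_la laD ST cS Tc dc.
    have ji : j = i by apply: (@beta_inj n la); rewrite // Ei Ej.
    have cx : c = x by apply: val_inj; rewrite vx Ec ji.
    by move: nx; rewrite -cx cS Tc eqxx.
  have [sub T0 Tr Tb Tv] := ST; split.
    apply/asboolP; split=> // c cS.
    by case/orP: (Tv c cS) => [->//|/andP[-> /=]]; rewrite orbC => /leqW ->.
  apply/negP => /andP[xS /eqP Tx].
  by have := Tv x xS; rewrite Tx ltnn eqxx /= dx ltnn.
(* If the corner lies in the inner shape, both sides are empty sums. *)
have [x_nu|x_nu] := boolP (val x \in diagram nu).
  rewrite big_pred0; last by move=> T; rewrite in_skew x_nu /= andbF.
  rewrite [X in _ = _ * X]big_pred0 ?mulr0 // => T; apply/negP => /asboolP[+ _ _ _ _].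
  rewrite /part_sub => /(@fsubsetP _ (diagram nu))/(_ _ x_nu).
  by rewrite Ela' in_fsetD1 vx eqxx.
have xS : val x \in skew la nu by rewrite in_skew x_nu vx x_la.
have skew' c : (val c \in skew la' nu) = (val c \in skew la nu) && (c != x).
  by rewrite !in_skew Ela' in_fsetD1 -vx (inj_eq val_inj) [(c != x) && _]andbC andbA.
pose put (T : {ffun D -> 'I_M.+1}) : {ffun D -> 'I_M.+1} :=
  [ffun c => if c == x then inord v else T c].
pose clr (T : {ffun D -> 'I_M.+1}) : {ffun D -> 'I_M.+1} :=
  [ffun c => if c == x then ord0 else T c].
have vK : (inord v : 'I_M.+1) = v :> nat by rewrite inordK.
rewrite (reindex_onto put clr) /=; last first.
  move=> T /and3P[_ _ /eqP Tx]; apply/ffunP => c; rewrite !ffunE.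
  by case: eqP => [->|//]; apply: val_inj; rewrite /= vK Tx.
rewrite big_distrr /=; apply: eq_big => [T|T _]; last first.
  rewrite (bigD1 x) //= !ffunE eqxx vK dx; congr (_ * _).
  apply: eq_big => [c|c /andP[_ /negPf cx]]; first by rewrite skew'.
  by rewrite ffunE cx.
rewrite xS /= ffunE eqxx vK eqxx andbT.
have right_x d : val d = right_of (val x) -> val d \notin skew la nu.
  by move=> ->; rewrite in_skew negb_and orbC vx mem_diagram /= ltnn.
have below_x d : val d = below (val x) -> val d \notin skew la nu.
  move=> ->; rewrite in_skew negb_and orbC vx mem_diagram /=.
  by rewrite [(_ <= prow la i.+1)%N]leqNgt cor andbF.
apply/andP/asboolP => [[/asboolP ST /eqP Tx]|[sub T0 Tr Tb Tv]].
- have putE c : c != x -> put T c = T c by rewrite ffunE => /negPf ->.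
  have [sub T0 Tr Tb Tv] := ST; split.
  + rewrite /part_sub Ela'; apply/fsubsetP => c c_nu.
    rewrite in_fsetD1 (fsubsetP sub _ c_nu) andbT.
    by apply: contra x_nu; rewrite vx => /eqP <-.
  + move=> c; rewrite skew' negb_and negbK => /orP[c_la|/eqP ->]; last first.
      by rewrite -Tx ffunE eqxx.
    by rewrite -putE ?T0 //; apply: contra c_la => /eqP ->.
  + move=> c d; rewrite !skew' => /andP[cS cx] /andP[dS dx'] E.
    by rewrite -!putE // Tr.
  + move=> c d; rewrite !skew' => /andP[cS cx] /andP[dS dx'] E.
    by rewrite -!putE // Tb.
  + move=> c; rewrite skew' => /andP[cS cx]; have := Tv c cS; rewrite putE //.
    case/orP => [->//|/andP[/eqP Tc]]; rewrite Tc eqxx ltnn /=.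
    rewrite ltnS leq_eqVlt => /orP[/eqP dc|//].
    have Tc' : put T c = v :> nat by rewrite putE.
    have [j [Ec lt_jn Ej _]] := ssyt_corner size_la laD ST cS Tc' dc.
    have ji : j = i by apply: (@beta_inj n la); rewrite // Ei Ej.
    by case/eqP: cx; apply: val_inj; rewrite vx Ec ji.
- split; last first.
    apply/eqP/ffunP => c; rewrite !ffunE; case: eqP => [->|//].
    by rewrite T0 // skew' eqxx andbF.
  have inS c : val c \in skew la nu -> c != x -> val c \in skew la' nu.
    by rewrite skew' => -> ->.
  apply/asboolP; split.
  + exact: part_sub_trans sub (remove_box_sub rem).
  + move=> c cS; rewrite ffunE ifF.
      by apply: T0; rewrite skew' (negPf cS).
    by apply/negP => /eqP cx; rewrite cx xS in cS.
  + move=> c d cS dS E; rewrite !ffunE.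
    case: (eqVneq c x) => [cx|cx].
      by move: dS; rewrite (negPf (right_x d _)) // -cx.
    case: (eqVneq d x) => [_|dx']; last by apply: Tr; rewrite ?inS.
    by rewrite vK; case/orP: (Tv c (inS c cS cx)) => [/ltnW//|/andP[/eqP -> _]].
  + move=> c d cS dS E; rewrite !ffunE.
    case: (eqVneq c x) => [cx|cx].
      by move: dS; rewrite (negPf (below_x d _)) // -cx.
    case: (eqVneq d x) => [dx'|dx']; last by apply: Tb; rewrite ?inS.
    rewrite vK; case/orP: (Tv c (inS c cS cx)) => [//|/andP[_]].
    by move: dx; rewrite -dx' E /diag_index /=; lia.
  + move=> c cS; rewrite !ffunE; case: (eqVneq c x) => [->|cx].
      by rewrite vK eqxx dx leqnn orbT.
    case/orP: (Tv c (inS c cS cx)) => [->//|/andP[-> /=]].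
    by rewrite orbC => /leqW ->.
Qed.

Lemma ssyt_sum_base la nu : (diagram la `<=` D)%fset ->
  ssyt_sum M 0 la nu = (la == nu)%:R.
Proof.
move=> laD; rewrite /ssyt_sum; have [<-|neq] := eqVneq la nu.
  have E c : val c \notin skew la la by rewrite in_skew andNb.
  rewrite (big_pred1 [ffun=> ord0]); last first.
    move=> T; apply/asboolP/eqP => [[_ T0 _ _ _]|->].
      by apply/ffunP => c; rewrite ffunE T0.
    split; [exact: part_sub_refl|by move=> c _; rewrite ffunE| | |];
    by move=> c; rewrite (negPf (E c)).
  by rewrite big_pred0 // => c; apply/negbTE.
rewrite big_pred0 // => T; apply/negP => /asboolP[sub _ _ _ TM].
case/eqP: neq; apply: diagram_inj; apply/eqP; rewrite eqEfsubset.
apply/andP; split; last exact: sub.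
apply/fsubsetP => c c_la; apply/negPn/negP => c_nu.
have := TM [` fsubsetP laD _ c_la]%fset; rewrite in_skew c_nu => /(_ c_la).
by rewrite ltn0 andbF orbF ltnNge -ltnS ltn_ord.
Qed.

(** [B] exceeds [n] plus the content of every cell, so that the diagonals below
    [B] exhaust the shape. *)
Definition fits B la : Prop :=
  [/\ (diagram la `<=` D)%fset, (size la <= n)%N & (prow la 0 + n <= B)%N].

Lemma fits_sub B la la' : part_sub la' la -> fits B la -> fits B la'.
Proof.
move=> sub [laD size_la la_B]; split.
- exact: fsubset_trans laD.
- exact: part_sub_size sub size_la.
- by apply: leq_trans la_B; rewrite leq_add2r; move/part_subP: sub.
Qed.

Lemma ssyt_sum_level B v la nu : fits B la ->
  ssyt_sum v 0 la nu = ssyt_sum v.+1 B la nu.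
Proof.
move=> [_ size_la la_B]; apply: eq_bigl => T; apply: asbool_equiv_eq.
have E (c : D) : val c \in skew la nu ->
    (v < T c)%N || (T c == v :> nat) && (diag_index n (val c) < 0)%N =
    (v.+1 < T c)%N || (T c == v.+1 :> nat) && (diag_index n (val c) < B)%N.
  rewrite in_skew => /andP[_ /mem_diagram_row[i [j [-> lt_j lt_i]]]].
  have -> : (diag_index n (i.+1, j.+1) < B)%N.
    by rewrite /diag_index /=; have := prow_anti la (leq0n i); lia.
  by rewrite ltn0 andbF orbF andbT leq_eqVlt orbC eq_sym.
split=> -[sub T0 Tr Tb Tv]; split=> // c cS; first by rewrite -E // Tv.
by rewrite E // Tv.
Qed.

Lemma ssyt_sum_boxes B v K (s : seq intpart) (f : intpart -> R)
    (N : nat -> 'rV[R]_n) : (v <= M)%N ->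
    (forall la, fits B la -> (forall nu, part_sub nu la -> nu \in s) ->
      \sum_(nu <- s) ssyt_sum v 0 la nu * f nu = minor N la) ->
  forall la, fits B la -> (forall nu, part_sub nu la -> nu \in s) ->
    \sum_(nu <- s) ssyt_sum v K la nu * f nu = minor (box_rows (w v) N K) la.
Proof.
move=> le_vM base; elim: K => [//|K IH] la fits_la in_s /=.
have [laD size_la _] := fits_la.
have [[i [lt_in Ei cor]]|nocor] := pselect (exists i,
    [/\ (i < n)%N, beta n la i = K & (prow la i.+1 < prow la i)%N]); last first.
  have nocor' i : (i < n)%N -> beta n la i = K -> prow la i.+1 = prow la i.
    move=> lt_in Ei; apply/eqP; rewrite eqn_leq prow_le /= leqNgt.
    by apply/negP => cor; apply: nocor; exists i.
  rewrite minor_row_step_id // -IH //; apply: eq_bigr => nu _.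
  by rewrite ssyt_sum_step_id.
have [la' rem] := remove_box_ex cor.
have sub := remove_box_sub rem.
rewrite (minor_row_step_remove _ _ size_la lt_in Ei rem) -!IH //; last 2 first.
- exact: fits_sub fits_la.
- by move=> nu nu_la'; apply: in_s; apply: part_sub_trans sub.
rewrite big_distrr -big_split /=; apply: eq_bigr => nu _.
by rewrite (@ssyt_sum_step_remove v K la nu i la') // mulrDl mulrA.
Qed.

(** Removing one cell from the outer shape obeys the same recursion for tableau
    sums and for minors, and both start from [minor N] itself. *)
Lemma ssyt_sum_minor B (s : seq intpart) (N : nat -> 'rV[R]_n) la :
    uniq s -> fits B la -> (forall nu, part_sub nu la -> nu \in s) ->
  \sum_(nu <- s) ssyt_sum 0 B la nu * minor N nu =
  minor (rows_from w M.+1 0 N) la.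
Proof.
move=> uniq_s.
have full v (N' : nat -> 'rV[R]_n) la' : fits B la' ->
    minor (box_rows (w v) N' B) la' = minor (strip_rows (w v) N') la'.
  move=> [_ _ la_B]; apply: eq_minor => i lt_in; rewrite box_rowsE ifT //.
  by rewrite /beta; have := prow_anti la' (leq0n i); lia.
suff gen (d v : nat) : (v + d)%N = M -> forall la, fits B la ->
    (forall nu, part_sub nu la -> nu \in s) ->
    \sum_(nu <- s) ssyt_sum v B la nu * minor N nu =
    minor (rows_from w d.+1 v N) la by exact: gen.
elim: d v => [|d IH] v vd {}la fits_la in_s.
  rewrite [RHS]/= -full //; apply: (@ssyt_sum_boxes B) => // [|{fits_la in_s}la [laD _ _] in_s].
    by rewrite -vd leq_addr.
  rewrite (bigD1_seq la) ?in_s ?part_sub_refl //= big1 ?addr0.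
    by rewrite -[v]addn0 vd ssyt_sum_base // eqxx mul1r.
  move=> nu; rewrite eq_sym -[v]addn0 vd ssyt_sum_base // => /negPf ->.
  by rewrite mul0r.
rewrite [RHS](_ : _ = minor (strip_rows (w v) (rows_from w d.+1 v.+1 N)) la) //.
rewrite -full //; apply: (@ssyt_sum_boxes B) => // [|{fits_la in_s}la fits_la in_s].
  by rewrite -vd leq_addr.
rewrite -IH //; last by rewrite addSnnS.
by apply: eq_bigr => nu _; rewrite (@ssyt_sum_level B).
Qed.

End TableauSums.

(** * Lecture hall and content tableaux as weighted fillings *)

Section Recoding.
Variables (R : comNzRingType) (n B M : nat) (la nu : intpart).
Local Notation D := (diagram la).
Hypothesis fits_la : fits n D B la.
Implicit Types (c d : skew la nu) (T : tableau la nu).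

Local Notation k c := (diag_index n (val c)).

Lemma diag_index_bounds (c : nat * nat) : c \in D ->
  (0 < diag_index n c < B)%N /\ (c.1 <= n)%N.
Proof.
have [_ size_la la_B] := fits_la; move=> /mem_diagram_row[i [j [-> lt_j lt_i]]].
by have := prow_anti la (leq0n i); rewrite /diag_index /=; lia.
Qed.

Lemma skew_diagram c : val c \in D.
Proof. by have := valP c; rewrite in_skew => /andP[]. Qed.

Lemma diag_index_content c :
  n%:Z + content (val c) = (k c)%:Z.
Proof.
have [] := diag_index_bounds (skew_diagram c).
by rewrite /diag_index /content; lia.
Qed.

Lemma lh_ratioE T c : lh_ratio n T c = (T c)%:R / (k c)%:R.
Proof. by rewrite /lh_ratio diag_index_content pmulrn. Qed.

Lemma floor_tableauE T c : floor_tableau n T c = (T c %/ k c)%N.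
Proof.
have [/andP[k0 _] _] := diag_index_bounds (skew_diagram c).
have k0' : 0 < (k c)%:R :> rat by rewrite ltr0n.
rewrite ffunE lh_ratioE; apply: truncn_def.
by rewrite ler_pdivlMr // ltr_pdivrMr // -!natrM ler_nat ltr_nat leq_trunc_div ltn_ceil.
Qed.

Lemma diag_index_right c d : val d = right_of (val c) -> k d = (k c).+1.
Proof.
have [] := diag_index_bounds (skew_diagram c).
by move=> + + ->; rewrite /diag_index /=; lia.
Qed.

Lemma diag_index_below c d : val d = below (val c) -> k c = (k d).+1.
Proof.
have [] := diag_index_bounds (skew_diagram c).
have [] := diag_index_bounds (skew_diagram d).
by move=> + + + + E; rewrite E /diag_index /=; lia.
Qed.

(** The lexicographic order on quotient and remainder, read as the usual order
    on numbers; all remainders are below [B]. *)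
Definition lh_code i x : nat := (x %/ i * B + x %% i)%N.

(** Put [x = q i + r] and [y = q' (i + 1) + r'].  If [q] and [q'] differ they
    decide both comparisons.  If they agree the right-hand side reads
    [r' i <= r (i + 1)], that is [r' <= r + r / i], and [r < i]. *)
Lemma lh_code_le i x y : (0 < i < B)%N ->
  (lh_code i.+1 y <= lh_code i x)%N = (y * i <= x * i.+1)%N.
Proof.
move=> /andP[i0 iB]; rewrite /lh_code.
rewrite {3}(divn_eq y i.+1) {3}(divn_eq x i).
have := ltn_pmod y (ltn0Sn i); have := ltn_pmod x i0.
move: (y %/ i.+1)%N (y %% i.+1)%N (x %/ i)%N (x %% i)%N => q' r' q r lt_r lt_r'.
have [lt|lt|->] := ltngtP q q'; apply/idP/idP; nia.
Qed.

Hypothesis nu_sub : part_sub nu la.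

(** Tableaux in arbitrary entries, once recoded cell by cell into
    semistandard fillings; [ok] marks the codes that come from an entry, and the
    other codes have weight zero. *)
Lemma ssyt_sum_recode (w : nat -> nat -> R) (enc dec : nat -> nat -> nat)
    (ok : nat -> nat -> bool) (A : set (tableau la nu)) :
    (forall i x, (0 < i < B)%N -> dec i (enc i x) = x) ->
    (forall i e, (0 < i < B)%N -> ok i e -> enc i (dec i e) = e) ->
    (forall i e, ~~ ok i e -> w e i = 0) ->
    (forall T, A T <->
      [/\ forall c d, val d = right_of (val c) ->
            (enc (k d) (T d) <= enc (k c) (T c))%N,
          forall c d, val d = below (val c) ->
            (enc (k d) (T d) < enc (k c) (T c))%N
        & forall c, (enc (k c) (T c) <= M)%N /\ ok (k c) (enc (k c) (T c))]) ->
  ssyt_sum n D M w 0 B la nu =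
  \sum_(T \in A) \prod_c w (enc (k c) (T c)) (k c).
Proof.
move=> encK decK w0 AE.
have kB c : (0 < k c < B)%N by have [] := diag_index_bounds (skew_diagram c).
pose inc c : D := [` skew_diagram c]%fset.
have incK (c : D) : val c \in skew la nu ->
    exists2 c' : skew la nu, c = inc c' & val c' = val c.
  by move=> cS; exists [` cS]%fset => //; apply: val_inj.
pose P : set {ffun D -> 'I_M.+1} := [set F | ssyt n 0 B la nu F /\
  forall c, ok (k c) (F (inc c))].
pose h (F : {ffun D -> 'I_M.+1}) : tableau la nu :=
  [ffun c => dec (k c) (F (inc c))].
have hE F c : P F -> enc (k c) (h F c) = F (inc c).
  by move=> [_ okT]; rewrite ffunE decK.
have Pbij : set_bij P A h.
  split.
  - move=> T PT; apply/AE; have [[_ _ Tr Tb _] okT] := PT.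
    split=> [c d E|c d E|c]; rewrite !hE //; last by rewrite -ltnS ltn_ord.
    + exact: (Tr (inc c) (inc d) (valP c) (valP d) E).
    + exact: (Tb (inc c) (inc d) (valP c) (valP d) E).
  - move=> T1 T2; rewrite !inE => PT1 PT2 E; apply/ffunP => c.
    have [cS|cS] := boolP (val c \in skew la nu).
      have [c' -> _] := incK c cS; apply: val_inj => /=.
      by rewrite -(hE T1) // -(hE T2) // E.
    by have [[_ -> //= _ _ _] _] := PT1; have [[_ -> //= _ _ _] _] := PT2.
  - move=> T /AE[Tr Tb TM].
    pose T' : {ffun D -> 'I_M.+1} := [ffun c : D =>
      if insub (val c) is Some c' then inord (enc (k c') (T c')) else ord0].
    have T'E c : T' (inc c) = enc (k c) (T c) :> nat.
      by rewrite ffunE /= valK inordK // ltnS; have [] := TM c.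
    exists T'; last first.
      by apply/ffunP => c; rewrite ffunE T'E encK.
    split; last by move=> c; rewrite T'E; have [] := TM c.
    split=> //.
    + by move=> c cS; rewrite ffunE insubN.
    + move=> c d /incK[c' -> _] /incK[d' -> _] E.
      by rewrite !T'E; apply: Tr.
    + move=> c d /incK[c' -> _] /incK[d' -> _] E.
      by rewrite !T'E; apply: Tb.
    + move=> c /incK[c' -> _]; rewrite T'E.
      by have /andP[_ ->] := kB c'; case: posnP => // ->.
rewrite [RHS](@reindex_fsbig _ _ _ _ _ h P A _ Pbij) /ssyt_sum.
rewrite [LHS]bigfs ?index_enum_uniq //; last first.
  by move=> T _; rewrite mem_index_enum.
have prodE (T : {ffun D -> 'I_M.+1}) :
    \prod_(c : D | val c \in skew la nu) w (T c) (diag_index n (val c)) =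
    \prod_(c : skew la nu) w (T (inc c)) (k c).
  rewrite (reindex_omap inc (fun c : D => insub (val c))) /=; last first.
    move=> c cS; rewrite insubT /=; congr Some; exact: val_inj.
  by apply: eq_bigl => c; rewrite valK eqxx andbT (valP c).
under eq_fsbigr do rewrite prodE.
transitivity (\sum_(F \in P) \prod_(c : skew la nu) w (F (inc c)) (k c)).
  symmetry; apply: fsbig_widen; first by move=> F [SF _]; apply/asboolP.
  move=> F [/asboolP SF notP] /=.
  have [c nok] : exists c, ~~ ok (k c) (F (inc c)).
    apply: contrapT => all_ok; apply: notP; split=> // c.
    by apply/negPn/negP => nok; apply: all_ok; exists c.
  by rewrite (bigD1 c) //= w0 // mul0r.
apply: eq_fsbigr => F; rewrite inE => PF; apply: eq_bigr => c _.
by rewrite hE.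
Qed.

(** The column condition is the negation of [lh_code_le] read from the lower
    cell to the upper one. *)
Lemma ssyt_sum_LHT Q (z : nat -> R) : M.+1 = (Q * B)%N ->
  ssyt_sum n D M (fun e i => if (e %% B < i)%N then z (e %/ B)%N else 0)
    0 B la nu =
  \sum_(T \in LHT n la nu `&` [set T | forall c, (floor_tableau n T c < Q)%N])
     \prod_c z (floor_tableau n T c).
Proof.
move=> QB.
have modB i x : (0 < i < B)%N -> (x %% i < B)%N.
  by move=> /andP[i0 iB]; apply: ltn_trans iB; rewrite ltn_pmod.
have codeE i x : (0 < i < B)%N ->
    (lh_code i x %/ B = x %/ i /\ lh_code i x %% B = x %% i)%N.
  move=> iB; have B0 : (0 < B)%N by case/andP: iB => _ /ltn_predK <-.
  have lt_B := modB _ x iB; rewrite /lh_code modnMDl divnMDl //.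
  by rewrite (modn_small lt_B) (divn_small lt_B) addn0.
have kB c : (0 < k c < B)%N by have [] := diag_index_bounds (skew_diagram c).
have ratio_le c d T : (lh_ratio n T d <= lh_ratio n T c) = (T d * k c <= T c * k d)%N.
  have /andP[c0 _] := kB c; have /andP[d0 _] := kB d.
  rewrite !lh_ratioE ler_pdivrMr ?ltr0n // mulrAC ler_pdivlMr ?ltr0n //.
  by rewrite -!natrM ler_nat.
rewrite (@ssyt_sum_recode _ lh_code (fun i e => e %/ B * i + e %% B)%N
  (fun i e => e %% B < i)%N
  (LHT n la nu `&` [set T | forall c, (floor_tableau n T c < Q)%N])).
- apply: eq_fsbigr => T _; apply: eq_bigr => c _.
  have [-> ->] := codeE _ (T c) (kB c); have /andP[c0 _] := kB c.
  by rewrite ltn_pmod // floor_tableauE.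
- by move=> i x iB; have [-> ->] := codeE _ x iB; rewrite -divn_eq.
- move=> i e /andP[i0 iB] lt_e; rewrite /lh_code divnMDl // modnMDl.
  by rewrite (divn_small lt_e) (modn_small lt_e) addn0 -divn_eq.
- by move=> i e /negPf ->.
move=> T; split.
- move=> [[Tr Tb] TQ]; split.
  + move=> c d E; rewrite (diag_index_right E) lh_code_le ?kB //.
    by rewrite -(diag_index_right E) -ratio_le Tr.
  + move=> c d E; rewrite (diag_index_below E) ltnNge lh_code_le ?kB //.
    by rewrite -(diag_index_below E) -ratio_le -ltNge Tb.
  + move=> c; have [cd cm] := codeE _ (T c) (kB c); have /andP[c0 _] := kB c.
    split; last by rewrite cm ltn_pmod.
    rewrite -ltnS QB -ltn_divLR; last by have := kB c; lia.
    by rewrite cd -floor_tableauE TQ.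
- move=> [Tr Tb TQ]; split; first split.
  + move=> c d E; rewrite ratio_le (diag_index_right E) -lh_code_le ?kB //.
    by rewrite -(diag_index_right E) Tr.
  + move=> c d E; rewrite ltNge ratio_le (diag_index_below E) -lh_code_le ?kB //.
    by rewrite -(diag_index_below E) -ltnNge Tb.
  + move=> c /=; have [le_M _] := TQ c; have [cd _] := codeE _ (T c) (kB c).
    rewrite floor_tableauE -cd ltn_divLR -?QB ?ltnS //.
    by have := kB c; lia.
Qed.

Lemma ssyt_sum_SSCT (z : nat -> R) : (B <= M.+1)%N ->
  ssyt_sum n D M (fun e i => if (e < i)%N then z e else 0) 0 B la nu =
  \sum_(T \in SSCT n la nu) \prod_c z (T c).
Proof.
move=> BM.
have kB c : (0 < k c < B)%N by have [] := diag_index_bounds (skew_diagram c).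
rewrite (@ssyt_sum_recode _ (fun=> id) (fun=> id) (fun i e => e < i)%N
  (SSCT n la nu)) //.
- apply: eq_fsbigr => T; rewrite inE => -[_ _ Tk]; apply: eq_bigr => c _.
  by have := Tk c; rewrite diag_index_content ltz_nat => ->.
- by move=> i e /negPf ->.
move=> T; split=> -[Tr Tb Tk]; split=> // c.
- have := Tk c; rewrite diag_index_content ltz_nat => lt_k; split=> //.
  by have := kB c; lia.
- by rewrite diag_index_content ltz_nat; have [] := Tk c.
Qed.

End Recoding.

(** * The identity in finitely many variables *)

Section FiniteIdentity.
Variables (R : comNzRingType) (n : nat).
Implicit Types (la mu nu : intpart) (z : nat -> R).

Definition ssct_sum la mu z : R := \sum_(T \in SSCT n la mu) \prod_c z (T c).

Definition bounded_lht_sum Q la mu z : R :=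
  \sum_(T \in LHT n la mu `&` [set T | forall c, (floor_tableau n T c < Q)%N])
     \prod_c z (floor_tableau n T c).

Lemma fits_diagram B la : (size la <= n)%N -> (prow la 0 + n <= B)%N ->
  fits n (diagram la) B la.
Proof. by split=> //; apply: fsubset_refl. Qed.

Lemma beta_bound la i : (i < n)%N -> (beta n la i < prow la 0 + n)%N.
Proof. by move=> lt_in; rewrite /beta; have := prow_anti la (leq0n i); lia. Qed.

Definition subparts la : seq intpart :=
  fset_set [set nu : intpart | part_sub nu la].

Lemma mem_subparts la nu : (nu \in subparts la) = part_sub nu la.
Proof.
rewrite /subparts in_fset_set; first by apply/idP/idP; rewrite inE.
have empty_part : sorted geq [::] && (0%N \notin [::]) by [].
apply: sub_finite_set (part_interval_finite (IntPart empty_part) la) => mu mu_la.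
by split=> //; apply/part_subP => i; rewrite /prow nth_nil.
Qed.

Lemma subparts_uniq la : uniq (subparts la).
Proof. exact: fset_uniq. Qed.

(** [ssyt_sum_minor] with the minors of the unit rows keeps the single term
    [nu = mu]. *)
Lemma newton_minor la mu z : (size mu <= n)%N -> (size la <= n)%N ->
  minor (newton_rows z (unit_rows R n mu)) la =
  if part_sub mu la then ssct_sum la mu z else 0.
Proof.
move=> size_mu size_la; set B := (prow la 0 + n).+1.
have fits_la : fits n (diagram la) B la by apply: fits_diagram.
pose w e i := if (e < i)%N then z e else 0.
transitivity (minor (rows_from w B 0 (unit_rows R n mu)) la).
  apply: eq_minor => i lt_in; symmetry; apply: rows_from_newton => //.
  exact/ltnW/leqW/beta_bound.
rewrite -(ssyt_sum_minor (prow la 0 + n) w _ (subparts_uniq la) fits_la); last first.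
  by move=> nu; rewrite mem_subparts.
have term nu : part_sub nu la ->
    minor (unit_rows R n mu) nu = (nu == mu)%:R.
  by move=> nu_la; rewrite minor_unit_rows // (part_sub_size nu_la).
have [mu_la|mu_la] := boolP (part_sub mu la).
  rewrite (bigD1_seq mu) ?subparts_uniq ?mem_subparts //= big1_seq ?addr0.
    by rewrite term // eqxx mulr1 ssyt_sum_SSCT.
  move=> nu /andP[/negPf ne]; rewrite mem_subparts => nu_la.
  by rewrite term // ne mulr0.
rewrite big1_seq // => nu; rewrite mem_subparts => /andP[_ nu_la].
rewrite term //; case: eqP => [E|_]; last by rewrite mulr0.
by move: mu_la; rewrite -E nu_la.
Qed.

Lemma bounded_lht_minor Q la z (N : nat -> 'rV[R]_n) : (size la <= n)%N ->
  (0 < Q)%N ->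
  \sum_(nu <- subparts la) bounded_lht_sum Q la nu z * minor N nu =
  minor (newton_rows (fun=> \sum_(q < Q) z q) N) la.
Proof.
move=> size_la Q0; set B := (prow la 0 + n).+1.
have fits_la : fits n (diagram la) B la by apply: fits_diagram.
pose w e i := if (e %% B < i)%N then z (e %/ B)%N else 0.
have EM : (Q * B).-1.+1 = (Q * B)%N by rewrite prednK // muln_gt0 Q0.
transitivity (minor (rows_from w (Q * B) 0 N) la); last first.
  apply: eq_minor => i lt_in.
  rewrite -[X in rows_from _ _ X](mul0n B) (@rows_from_blocks _ _ w z) //.
  exact/ltnW/leqW/beta_bound.
rewrite -EM -(ssyt_sum_minor _ w N (subparts_uniq la) fits_la).
  apply: eq_big_seq => nu; rewrite mem_subparts => nu_la.
  by rewrite (ssyt_sum_LHT fits_la nu_la z EM).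
by move=> nu; rewrite mem_subparts.
Qed.

Lemma ssct_sum_shift Q la mu (x y : nat -> R) : part_sub mu la -> (size la <= n)%N ->
  (0 < Q)%N ->
  ssct_sum la mu (fun k => \sum_(q < Q) x q + y k) =
  \sum_(nu \in [set nu : intpart | part_sub mu nu /\ part_sub nu la])
    bounded_lht_sum Q la nu x * ssct_sum nu mu y.
Proof.
move=> mu_la size_la Q0.
have size_mu := part_sub_size mu_la size_la.
have -> : ssct_sum la mu (fun k => \sum_(q < Q) x q + y k) =
    minor (newton_rows (fun k => \sum_(q < Q) x q + y k) (unit_rows R n mu)) la.
  by rewrite newton_minor // mu_la.
rewrite newton_rows_shift -bounded_lht_minor //.
rewrite (eq_big_seq (fun nu => if part_sub mu nu then
   bounded_lht_sum Q la nu x * ssct_sum nu mu y else 0)); last first.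
  move=> nu; rewrite mem_subparts => nu_la.
  rewrite newton_minor ?(part_sub_size nu_la) //.
  by case: ifP; rewrite ?mulr0.
rewrite -big_mkcond -big_filter; symmetry; apply: fsbig_fwiden.
- by move=> nu [mu_nu nu_la] /=; rewrite mem_filter mem_subparts mu_nu.
- by rewrite filter_uniq // subparts_uniq.
- move=> nu /= [+ nmem]; rewrite mem_filter mem_subparts => /andP[mu_nu nu_la].
  by case: nmem.
Qed.

End FiniteIdentity.

(** * Finitely many variables suffice for each coefficient *)

Section Truncation.
Variables (R : comNzRingType) (Q : nat).

(** The series are compared on the monomials whose x-variables have index below
    [Q]; these monomials are closed under taking divisors, so that comparison is
    compatible with sums and products. *)
Definition low (m : {mset (nat + nat)}%mset) : Prop :=
  forall k, inl k \in m -> (k < Q)%N.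

Definition eq_low (f g : fps R (nat + nat)%type) : Prop :=
  forall m, low m -> f m = g m.

Lemma eq_low_mul f f' g g' :
  eq_low f f' -> eq_low g g' -> eq_low (f * g) (f' * g').
Proof.
move=> ff gg m low_m; rewrite [LHS]/(fps_mul f g m) [RHS]/(fps_mul f' g' m).
apply: eq_fsbigr => -[a b]; rewrite inE /= => abm; congr (_ * _).
- by apply: ff => k ka; apply: low_m; rewrite -abm in_msetD ka.
- by apply: gg => k kb; apply: low_m; rewrite -abm in_msetD kb orbT.
Qed.

Lemma eq_low_prod (I : Type) (r : seq I) (P : pred I) (F G : I -> fps R (nat + nat)%type) :
  (forall i, eq_low (F i) (G i)) ->
  eq_low (\prod_(i <- r | P i) F i) (\prod_(i <- r | P i) G i).
Proof.
by move=> FG; apply: big_ind2 => // f f' g g'; apply: eq_low_mul.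
Qed.

Lemma eq_low_fsum (I : choiceType) (A : set I) (F G : I -> fps R (nat + nat)%type) :
  finite_set A -> (forall i, A i -> eq_low (F i) (G i)) ->
  eq_low (\sum_(i \in A) F i) (\sum_(i \in A) G i).
Proof.
move=> finA FG; rewrite !fsbig_finite //= big_seq [X in eq_low _ X]big_seq.
apply: big_ind2 => // [f f' g g' E E' m low_m|i].
  by rewrite [LHS]/(f m + g m) [RHS]/(f' m + g' m) E ?E'.
by rewrite in_fset_set // inE; apply: FG.
Qed.

Lemma fsum_coef (I : choiceType) (A : set I) (F : I -> fps R (nat + nat)%type) m :
  finite_set A -> (\sum_(i \in A) F i) m = \sum_(i \in A) F i m.
Proof.
move=> finA; rewrite !fsbig_finite //=.
by apply: (big_ind2 (fun (f : fps R (nat + nat)%type) a => f m = a)) => //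
  f _ g _ <- <-.
Qed.

Lemma eq_low_xsum :
  eq_low (fps_sum setT (xvar R)) (\sum_(q < Q) xvar R q).
Proof.
move=> m low_m; rewrite /fps_sum fsbig_ord.
rewrite fsum_coef; last exact: finite_II.
symmetry; apply: fsbig_widen => // k [_ /= kQ]; rewrite /xvar /fpsX.
case: eqP => // mk; case: kQ; apply: low_m.
by rewrite mk in_mset1.
Qed.

(** A tableau with a floor at least [Q] contributes a monomial containing some
    variable beyond the first [Q]. *)
Lemma eq_low_Lgf n (la nu : intpart) : (size la <= n)%N ->
  eq_low (Lgf n la nu (xvar R)) (bounded_lht_sum n Q la nu (xvar R)).
Proof.
move=> size_la m low_m; rewrite /Lgf /fps_sum /bounded_lht_sum.
rewrite fsum_coef; last first.
  have fits_la : fits n (diagram la) (prow la 0 + n).+1 la by exact: fits_diagram.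
  apply: sub_finite_set (bounded_tableaux_finite la nu (Q * (prow la 0 + n).+1)).
  move=> T [_ TQ] c; have := TQ c; rewrite (floor_tableauE fits_la).
  have [/andP[k0 kB] _] := diag_index_bounds fits_la (skew_diagram c).
  by rewrite ltn_divLR // => /leq_trans; apply; rewrite leq_mul2l (ltnW kB) orbT.
symmetry; apply: fsbig_widen => [T []//|T [LT nQ] /=].
apply: contrapT => Tm; apply: nQ; split=> // c.
apply: low_m.
exact: (@prod_xvar_neq0 _ _ _ (floor_tableau n T) _ Tm c (mem_index_enum _)).
Qed.

Lemma eq_low_Sgf n (la mu : intpart) (z z' : nat -> fps R (nat + nat)%type) :
    (size la <= n)%N -> (forall k, eq_low (z k) (z' k)) ->
  eq_low (Sgf n la mu z) (Sgf n la mu z').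
Proof.
move=> size_la zz'; apply: eq_low_fsum => [|T _]; first exact: SSCT_finite.
exact: eq_low_prod.
Qed.

End Truncation.

Lemma low_ex (m : {mset (nat + nat)}%mset) : exists Q, (0 < Q)%N /\ low Q m.
Proof.
exists (\max_(v : finsupp m) (if val v is inl k then k else 0%N)).+1; split=> // k km.
rewrite ltnS; have kS : inl k \in finsupp m by rewrite msuppE.
exact: (leq_bigmax [` kS]%fset).
Qed.

Theorem theorem1p6 (R : comNzRingType) (n : nat) (la mu : intpart)
    (mu_sub_la : part_sub mu la) (size_la : (size la <= n)%N) :
  Sgf n la mu (fun k => fps_sum setT (xvar R) + yvar R k) =
  \sum_(nu \in [set nu : intpart | part_sub mu nu /\ part_sub nu la])
    (Lgf n la nu (xvar R) * Sgf n nu mu (yvar R)).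
Proof.
apply/funext => m; have [Q [Q0 low_m]] := low_ex m.
(* Only the variables occurring in the monomial [m] matter. *)
transitivity (Sgf n la mu (fun k => \sum_(q < Q) xvar R q + yvar R k) m).
  apply: (@eq_low_Sgf R Q) => // k m' low_m'.
  have E := eq_low_xsum R low_m'.
  exact: (congr1 (fun r => r + yvar R k m') E).
rewrite [Sgf _ _ _ _](ssct_sum_shift _ _ mu_sub_la size_la Q0).
symmetry; apply: (@eq_low_fsum R Q) => // [|nu [_ nu_la]].
  exact: part_interval_finite.
by apply: eq_low_mul => //; apply: eq_low_Lgf.
Qed.
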